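(* Let $R$ be a ranking profile over $m\geq4$ candidates, let $\rhd$ be the ranking chosen by the Ranked Method of Equal Shares for $R$, and let $\xi=\binom{m-\lfloor m/4\rfloor}{2}$. Then for every subprofile $S$ of $R$ with $|S|>0$: if $\binom{m}{2}|S|-\frac12\leq\xi$, then $\frac{1}{|S|}\sum_{\succ\in\mathcal{R}}S(\succ)u(\succ,\rhd)\geq\binom{m}{2}\frac{|S|}{4}-\frac18$; and if $\binom{m}{2}|S|-\frac12>\xi$, then $$\frac{1}{|S|}\sum_{\succ\in\mathcal{R}}S(\succ)u(\succ,\rhd)\geq\frac12\binom{m}{2}\Big(1-\frac{\xi}{\binom{m}{2}|S|}\Big)+\frac{\xi+1}{4}\cdot\frac{\xi}{\binom{m}{2}|S|}-\frac{1}{4|S|}.$$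
   Context: Let $C$ be a set of $m$ candidates. A ranking is a strict linear order over $C$; $\mathcal{R}$ denotes the set of all rankings over $C$. A ranking profile is a function $R:\mathcal{R}\to[0,1]$ with $\sum_{\succ}R(\succ)=1$. A subprofile of $R$ is $S:\mathcal{R}\to[0,1]$ with $S(\succ)\leq R(\succ)$ for all $\succ$; $|S|=\sum_\succ S(\succ)$. For rankings $\succ,\rhd$, $u(\succ,\rhd)=|\{(x,y)\in C^2:x\succ y\text{ and }x\rhd y\}|$; for $x\in X\subseteq C$, $u(\succ,x,X)=|\{y\in X\setminus\{x\}:x\succ y\}|$. Ranked Method of Equal Shares: set $X_1=C$, $b_1(\succ)=R(\succ)\binom{m}{2}$. In each round $i\in\{1,\dots,m-2\}$, for each $x\in X_i$ let $\rho_x$ be the smallest $\rho\geq0$ with $\sum_{\succ}\min\big(\rho\,b_1(\succ)u(\succ,x,X_i),b_i(\succ),u(\succ,x,X_i)\big)=m-i$ ($\infty$ if none); choose $x_i$ minimizing $\rho_x$ (ties arbitrary), set $\rho_i=\rho_{x_i}$, place $x_i$ at position $i$, set $X_{i+1}=X_i\setminus\{x_i\}$, $b_{i+1}(\succ)=b_i(\succ)-\min(\rho_ib_1(\succ)u(\succ,x_i,X_i),b_i(\succ),u(\succ,x_i,X_i))$. For the last two candidates $x,y$, place $x$ at position $m-1$ if $\sum_{\succ:x\succ y}b_{m-1}(\succ)\geq\sum_{\succ:y\succ x}b_{m-1}(\succ)$, otherwise $y$. *)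

(* Defs.v *)
From HB Require Import structures.
From mathcomp Require Import all_boot all_order all_algebra all_fingroup.
From mathcomp Require Import reals.
Set Implicit Arguments. Unset Strict Implicit. Unset Printing Implicit Defensive.
Import Order.TTheory GRing.Theory Num.Theory.
Local Open Scope ring_scope.

(* Candidates are 'I_m.  A ranking is a permutation s : {perm 'I_m} read as
   "s x = position of candidate x" (0 = top); x is ranked above y iff s x < s y. *)
Definition above (m : nat) (s : {perm 'I_m}) (x y : 'I_m) : bool :=
  (s x < s y)%N.

Definition u_pair (m : nat) (s t : {perm 'I_m}) : nat :=
  #|[set p : 'I_m * 'I_m | above s p.1 p.2 && above t p.1 p.2]|.

Definition u_in (m : nat) (s : {perm 'I_m}) (x : 'I_m) (X : {set 'I_m}) : nat :=
  #|[set y in X | (y != x) && above s x y]|.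

Section RMES.
Variable R : realType.
Variable m : nat.
Notation rk := {perm 'I_m}.

Definition is_profile (P : {ffun rk -> R}) : Prop :=
  (forall s, 0 <= P s) /\ \sum_s P s = 1.

Definition is_subprofile (P S : {ffun rk -> R}) : Prop :=
  forall s, 0 <= S s <= P s.

Definition mass (S : {ffun rk -> R}) : R := \sum_s S s.

(* rounds are 0-indexed: round k (k < m-2) is round i = k+1 of the paper;
   X_k = candidates not yet placed = those at position >= k in the output t. *)
Definition remaining (t : rk) (k : nat) : {set 'I_m} := [set x | (k <= t x)%N].

Definition pay (b1 b : {ffun rk -> R}) (X : {set 'I_m}) (x : 'I_m) (rho : R) : R :=
  \sum_s Num.min (rho * b1 s * (u_in s x X)%:R)
                 (Num.min (b s) (u_in s x X)%:R).

(* rho_x for round k: Some r = the smallest r >= 0 with pay = m-(k+1);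
   None = infinity (no such r). *)
Definition is_rho (b1 b : {ffun rk -> R}) (X : {set 'I_m}) (k : nat) (x : 'I_m)
    (r : option R) : Prop :=
  match r with
  | Some r0 => 0 <= r0 /\ pay b1 b X x r0 = (m - k.+1)%:R /\
      (forall r', 0 <= r' -> r' < r0 -> pay b1 b X x r' != (m - k.+1)%:R)
  | None => forall r', 0 <= r' -> pay b1 b X x r' != (m - k.+1)%:R
  end.

Definition le_orho (a c : option R) : bool :=
  match a, c with
  | Some a0, Some c0 => a0 <= c0
  | Some _, None => true
  | None, None => true
  | None, Some _ => false
  end.

(* the charge to ranking s when x is chosen with rho; for rho = infinity,
   min(inf * b1 * u, b, u) = min(b, u) (when b1(s) u = 0 both sides are 0,
   since 0 <= b <= b1). *)
Definition charge (b1 b : {ffun rk -> R}) (X : {set 'I_m}) (x : 'I_m)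
    (rho : option R) (s : rk) : R :=
  match rho with
  | Some r => Num.min (r * b1 s * (u_in s x X)%:R)
                      (Num.min (b s) (u_in s x X)%:R)
  | None => Num.min (b s) (u_in s x X)%:R
  end.

(* t is a possible output (for some tie-breaking) of the Ranked Method of
   Equal Shares on profile P.  b k is the budget b_{k+1} of the paper,
   rho k is rho_{k+1}; t^-1 k is the candidate placed at position k. *)
Definition rmes_outcome (P : {ffun rk -> R}) (t : rk) : Prop :=
  exists (b : nat -> {ffun rk -> R}) (rho : nat -> option R),
    (forall s, b 0%N s = P s * ('C(m, 2))%:R) /\
    (forall k : 'I_m, (k < m - 2)%N ->
       let X := remaining t k in
       let xk := (t^-1)%g k in
       is_rho (b 0%N) (b k) X k xk (rho k) /\
       (forall x r, x \in X -> is_rho (b 0%N) (b k) X k x r ->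
          le_orho (rho k) r) /\
       (forall s, b k.+1 s = b k s - charge (b 0%N) (b k) X xk (rho k) s)) /\
    (forall (k1 k2 : 'I_m), val k1 = (m - 2)%N -> val k2 = (m - 1)%N ->
       let x := (t^-1)%g k1 in
       let y := (t^-1)%g k2 in
       \sum_(s | above s y x) b (m - 2)%N s <= \sum_(s | above s x y) b (m - 2)%N s).

End RMES.

(* Main.v *)
Require Import Defs.
From mathcomp Require Import classical_sets boolp.
From HB Require Import structures.
From mathcomp Require Import all_boot all_order all_algebra all_fingroup.
From mathcomp Require Import reals.
From mathcomp Require Import zify ring lra.
Import Order.TTheory GRing.Theory Num.Theory.
Local Open Scope ring_scope.

(* Fix a group S of total mass sigma and write M = C(m, 2); its initial budget is
   B = M sigma.  A ranking charged at price rho gains utility at least charge / (rho b_1),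
   so a round in which the group pays p yields it weighted utility at least p / rho.
   With n unplaced candidates the total remaining budget is T = C(n, 2), and an averaging
   argument gives rho <= 2 / T for n >= 4; the price never effectively exceeds 1, and
   the majority vote on the last pair is worth at least the leftover minus 1/2.  Hence a group
   whose remaining budget is c still collects at least c^2 / 4 - 1 / 16, which gives
   the first bound at c = B.  In the first floor(m / 4) rounds the same averaging with the
   initial budgets gives the better price rho <= 2 / M, which gives the second bound. *)

(** * Counting utilities over sets of candidates *)

Lemma u_inE (m : nat) (s : {perm 'I_m}) (x : 'I_m) (X : {set 'I_m}) :
  u_in s x X = (\sum_(y in X) (s x < s y))%N.
Proof.
rewrite /u_in -sum1_card big_mkcond [RHS]big_mkcond /=.
apply: eq_bigr => y _; rewrite inE /above.
have [->|_] := eqVneq y x; first by rewrite ltnn andbF; case: (x \in X).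
by case: (y \in X) => //=; case: (s x < s y)%N.
Qed.

Lemma u_in_lt (m : nat) (s : {perm 'I_m}) (x : 'I_m) (X : {set 'I_m}) :
  x \in X -> (u_in s x X < #|X|)%N.
Proof.
move=> xX; rewrite (cardsD1 x X) xX ltnS; apply: subset_leq_card.
by apply/subsetP => y; rewrite !inE => /and3P[-> -> _].
Qed.

(** Adding the sum to its copy with the summations exchanged counts every ordered pair of distinct
    members of [X] exactly once, since [s] ranks exactly one of the two first. *)
Lemma sum_u_in (m : nat) (s : {perm 'I_m}) (X : {set 'I_m}) :
  (\sum_(x in X) u_in s x X)%N = 'C(#|X|, 2).
Proof.
have double : (2 * \sum_(x in X) u_in s x X = #|X| * #|X|.-1)%N.
  rewrite mul2n -addnn; under eq_bigr do rewrite u_inE.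
  rewrite {2}exchange_big /= -big_split /=.
  transitivity (\sum_(x in X) #|X|.-1)%N; last by rewrite sum_nat_const.
  apply: eq_bigr => x xX; rewrite -big_split /=.
  rewrite (bigD1 x) //= ltnn add0n.
  have -> : #|X|.-1 = (\sum_(y in X | y != x) 1)%N.
    rewrite (cardsD1 x X) xX /= -sum1_card; apply: eq_bigl => y.
    by rewrite !inE andbC.
  apply: eq_bigr => y /andP[_ yx].
  have : s y != s x :> nat by rewrite (inj_eq val_inj) (inj_eq perm_inj).
  by case: ltngtP.
by rewrite bin2 -double mul2n doubleK.
Qed.

Lemma exists_top (m : nat) (s : {perm 'I_m}) (X : {set 'I_m}) :
  (0 < #|X|)%N -> exists2 x, x \in X & u_in s x X = #|X|.-1.
Proof.
case/card_gt0P => x0 x0X.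
have [x] := @arg_minnP _ x0 (mem X) (fun y => val (s y)) x0X.
rewrite -[mem X x]/(x \in X) => xX xmin.
exists x => //; rewrite (cardsD1 x X) xX /=; apply: eq_card => y.
rewrite !inE /above; have [|yx] := eqVneq y x; first by rewrite andbF.
rewrite /=; case yX : (y \in X) => //=.
have := xmin y yX; rewrite leq_eqVlt => /orP[/eqP e|//].
by move: yx; rewrite -(inj_eq (@perm_inj _ s)) -(inj_eq val_inj) e eqxx.
Qed.

Lemma card_remaining (m : nat) (t : {perm 'I_m}) (k : nat) :
  #|remaining t k| = (m - k)%N.
Proof.
have -> : remaining t k = t @^-1: [set i : 'I_m | (k <= i)%N].
  by apply/setP => x; rewrite !inE.
have -> : t @^-1: [set i : 'I_m | (k <= i)%N] =
          (t^-1)%g @: [set i : 'I_m | (k <= i)%N].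
  apply/setP => x; apply/idP/imsetP => [|[i]]; rewrite !inE.
    by move=> kx; exists (t x); rewrite ?inE ?permK.
  by move=> ki ->; rewrite permKV.
rewrite card_imset; last exact: perm_inj.
rewrite -sum1_card big_mkcond /=.
transitivity (\sum_(0 <= i < m) (k <= i : nat))%N.
  by rewrite big_mkord; apply: eq_bigr => i _; rewrite inE; case: (k <= i)%N.
have [km|mk] := leqP k m; last first.
  rewrite big_nat big1 => [|i /andP[_ im]]; last by rewrite leqNgt (ltn_trans im).
  by apply/esym/eqP; rewrite subn_eq0 ltnW.
rewrite (big_cat_nat (n := k)) //= big_nat big1 ?add0n => [|i /andP[_ ik]]; last first.
  by rewrite leqNgt ik.
rewrite big_nat (eq_bigr (fun=> 1%N)) => [|i /andP[-> _]//].
by rewrite -big_nat sum_nat_const_nat muln1.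
Qed.

(** Each agreeing pair is credited to the round that places its upper candidate; its lower candidate
    is then still unplaced. *)
Lemma u_pairE (m : nat) (s t : {perm 'I_m}) :
  u_pair s t = (\sum_(k < m) u_in s ((t^-1)%g k) (remaining t k))%N.
Proof.
rewrite (reindex_perm t) /=.
transitivity (\sum_x \sum_y (above s x y && above t x y : nat))%N.
  rewrite pair_big /= /u_pair -sum1_card big_mkcond /=.
  by apply: eq_bigr => -[x y] _; rewrite inE; case: (_ && _).
apply: eq_bigr => x _; rewrite permK u_inE big_mkcond [RHS]big_mkcond /=.
apply: eq_bigr => y _; rewrite inE /above.
case sxy: (s x < s y)%N => /=; last by case: ifP.
have : t x != t y :> nat.
  rewrite (inj_eq val_inj) (inj_eq perm_inj).
  by apply: contraTneq sxy => ->; rewrite ltnn.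
by case: ltngtP.
Qed.

(** * Existence of least prices, and their bound by averaging *)

(** An intermediate value argument: [pay] vanishes at price 0 and is Lipschitz in the price with
    constant [L], so the infimum of the prices that collect at least [c] collects exactly [c]. *)
Lemma exists_is_rho (R : realType) (m : nat) (b1 b : {ffun {perm 'I_m} -> R})
    (X : {set 'I_m}) (k : nat) (x : 'I_m) (rho : R) :
  (forall s, 0 <= b1 s) -> (forall s, 0 <= b s) -> 0 <= rho ->
  (m - k.+1)%:R <= pay b1 b X x rho ->
  exists2 r, is_rho b1 b X k x (Some r) & r <= rho.
Proof.
move=> b1_ge0 b_ge0 rho_ge0 rhoP; set c : R := (m - k.+1)%:R in rhoP *.
have c_ge0 : 0 <= c by exact: ler0n.
pose L : R := \sum_s b1 s * (u_in s x X)%:R.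
have L_ge0 : 0 <= L by apply: sumr_ge0 => s _; rewrite mulr_ge0.
have pay_lip r r' : r <= r' -> pay b1 b X x r' <= pay b1 b X x r + L * (r' - r).
  move=> rr'; rewrite /pay mulr_suml -big_split /=; apply: ler_sum => s _.
  have := b1_ge0 s; have : 0 <= (u_in s x X)%:R :> R by [].
  move: (b1 s) (u_in s x X)%:R (Num.min (b s) _) => p u z u_ge0 p_ge0.
  have pu_ge0 : 0 <= p * u * (r' - r) by rewrite !mulr_ge0 // subr_ge0.
  rewrite /Num.min; case: ifP => h1; case: ifP => h2; nra.
pose A : set R := [set r | 0 <= r /\ c <= pay b1 b X x r]%classic.
have lbA : has_lbound A by exists 0 => r [].
have neA : (A !=set0)%classic by exists rho.
have infA : has_inf A by [].
have r0_ge0 : 0 <= inf A by apply: lb_le_inf => // r [].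
exists (inf A); last by apply: (ge_inf lbA).
have small r : 0 <= r -> r < inf A -> pay b1 b X x r < c.
  move=> r_ge0 rA; rewrite ltNge; apply/negP => cr.
  by move: rA; rewrite ltNge (ge_inf lbA).
split => //; split; last by move=> r r_ge0 rA; rewrite lt_eqF // small.
apply/eqP; rewrite eq_le; apply/andP; split.
  have [r00|r0_gt0] := eqVneq (inf A) 0.
    rewrite r00 (le_trans _ c_ge0) // /pay big1 // => s _.
    by rewrite !mul0r; apply/min_idPl; rewrite le_min b_ge0 ler0n.
  apply/ler_addgt0Pr => e e_gt0.
  have {}r0_gt0 : 0 < inf A by rewrite lt_neqAle eq_sym r0_gt0.
  (* [inf A - d] stays nonnegative and [L * d <= e]; dividing by [L + 1] covers the case [L = 0]. *)
  pose d := Num.min (inf A) (e / (L + 1)).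
  have L1 : 0 < L + 1 by lra.
  have d_gt0 : 0 < d by rewrite lt_min r0_gt0 divr_gt0.
  have dA : d <= inf A by rewrite ge_min lexx.
  have dL : L * d <= e.
    have : d <= e / (L + 1) by rewrite ge_min lexx orbT.
    rewrite ler_pdivlMr //; nra.
  have h1 : pay b1 b X x (inf A - d) < c by apply: small; lra.
  have /pay_lip : inf A - d <= inf A by lra.
  by rewrite opprB addrCA subrr addr0; lra.
apply/ler_addgt0Pr => e e_gt0.
have L1 : 0 < L + 1 by lra.
have [r [r_ge0 cr] rA] := inf_adherent (divr_gt0 e_gt0 L1) infA.
have Ar : inf A <= r by apply: (ge_inf lbA).
apply: (le_trans cr); apply: (le_trans (pay_lip _ _ Ar)); rewrite lerD2l.
have : (r - inf A) < e / (L + 1) by lra.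
rewrite ltr_pdivlMr //; nra.
Qed.

(* Payments at [2 / W] average at least [#|X| - 1] over [X], unless a single ranking
   holds half of [W]; then its favourite in [X] gets [#|X| - 1] from it alone. *)
Lemma affordable_candidate (R : realType) (m : nat)
    (b1 b w : {ffun {perm 'I_m} -> R}) (X : {set 'I_m}) (W : R) :
  (0 < #|X|)%N -> 0 < W -> \sum_s w s = W ->
  (forall s, 0 <= w s <= b1 s) ->
  (forall s, 2 * w s * (#|X|.-1)%:R / W <= b s) ->
  exists2 x, x \in X & (#|X|.-1)%:R <= pay b1 b X x (2 / W).
Proof.
move=> X_gt0 W_gt0 sumw wb1 wb.
have u_le s x : x \in X -> (u_in s x X)%:R <= (#|X|.-1)%:R :> R.
  by move=> xX; rewrite ler_nat; have := @u_in_lt _ s x X xX; lia.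
have term_ge0 x s : 0 <= Num.min (2 / W * b1 s * (u_in s x X)%:R)
                           (Num.min (b s) (u_in s x X)%:R).
  have /andP[w0 w1] := wb1 s.
  rewrite !le_min ler0n andbT; apply/andP; split.
    by rewrite !mulr_ge0 ?invr_ge0 ?(ltW W_gt0) //; lra.
  by apply: le_trans (wb s); rewrite !mulr_ge0 ?invr_ge0 ?(ltW W_gt0).
have term_ge x s : x \in X -> 2 * w s * (u_in s x X)%:R / W <=
    Num.min (2 / W * b1 s * (u_in s x X)%:R) (b s).
  move=> xX; have /andP[w0 w1] := wb1 s; rewrite le_min; apply/andP; split.
    rewrite [leLHS](_ : _ = 2 / W * w s * (u_in s x X)%:R); last by ring.
    by rewrite ler_wpM2r // ler_wpM2l // divr_ge0 // ltW.
  apply: le_trans (wb s); rewrite ler_pM2r ?invr_gt0 //.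
  by apply: ler_wpM2l; [lra | exact: u_le].
have [[s ws]|big] := pselect (exists s, W / 2 <= w s).
  have [x xX ux] := @exists_top _ s X X_gt0; exists x => //.
  rewrite /pay (bigD1 s) //=.
  set rest := \sum_(i | _) _.
  have rest_ge0 : 0 <= rest by apply: sumr_ge0.
  suff : (#|X|.-1)%:R <= Num.min (2 / W * b1 s * (u_in s x X)%:R)
                           (Num.min (b s) (u_in s x X)%:R) by lra.
  rewrite minA le_min ux lexx andbT -ux; apply: le_trans (term_ge x s xX).
  rewrite ler_pdivlMr //; have : 0 <= (u_in s x X)%:R :> R by []. nra.
have wlt s : w s < W / 2 by rewrite ltNge; apply/negP => h; apply: big; exists s.
(* Now [2 * w s / W < 1], so the cap by the utility itself does not bind either. *)
have {}term_ge x s : x \in X -> 2 * w s * (u_in s x X)%:R / W <=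
    Num.min (2 / W * b1 s * (u_in s x X)%:R) (Num.min (b s) (u_in s x X)%:R).
  move=> xX; rewrite minA le_min term_ge //= ler_pdivrMr //.
  have := wlt s; have : 0 <= (u_in s x X)%:R :> R by []. nra.
apply: contrapT => none.
have : \sum_(x in X) pay b1 b X x (2 / W) < \sum_(x in X) (#|X|.-1)%:R.
  have /card_gt0P[x0 x0X] := X_gt0.
  apply: ltr_sum => [|x xX]; last first.
    by rewrite ltNge; apply/negP => h; apply: none; exists x.
  by apply/hasP; exists x0; rewrite ?mem_index_enum.
apply/negP; rewrite -leNgt.
apply: (@le_trans _ _ (\sum_(x in X) \sum_s 2 * w s * (u_in s x X)%:R / W)).
  rewrite exchange_big /=.
  rewrite (eq_bigr (fun s => w s * (2 * ('C(#|X|, 2))%:R / W))); last first.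
    move=> s _; rewrite -(@sum_u_in _ s X) natr_sum mulr_sumr mulr_suml mulr_sumr.
    by apply: eq_bigr => x _; ring.
  rewrite -mulr_suml sumw mulrCA divff ?gt_eqF // mulr1.
  rewrite sumr_const -[leLHS]mulr_natr -!natrM ler_nat.
  by rewrite mulnC -[X in (_ * X <= _)%N]bin1 mul_bin_diag.
by apply: ler_sum => x xX; apply: ler_sum => s _; exact: term_ge.
Qed.

(** * Three remaining candidates *)

Lemma u_in3 (m : nat) (s : {perm 'I_m}) (a b c : 'I_m) :
  a != b -> a != c -> b != c ->
  u_in s a [set a; b; c] = ((s a < s b) + (s a < s c))%N.
Proof.
move=> ab ac bc; rewrite u_inE setUC big_setU1 ?inE; last first.
  by rewrite !(eq_sym c) (negbTE ac) (negbTE bc).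
rewrite big_setU1 ?inE ?(negbTE ab) //= big_set1 ltnn; lia.
Qed.

(** The booleans record whether a ranking prefers a to b, a to c and b to c; the two excluded
    triples are cyclic. If a or b comes first, that candidate alone receives [w]. If c does, the
    better of a and b receives [Num.min w 1], which is [w] because the totals below 2 force it below
    1. *)
Lemma two_of_three (R : realType) (w w0 : R) (ab ac bc : bool) :
  0 <= w -> w < 2 -> 1 < w0 ->
  ~~ [&& ab, ~~ ac & bc] -> ~~ [&& ~~ ab, ac & ~~ bc] ->
  w0 + Num.min w (ab + ac)%:R < 2 -> 1 + Num.min w (~~ ab + bc)%:R < 2 ->
  w <= Num.min w (ab + ac)%:R + Num.min w (~~ ab + bc)%:R.
Proof.
move=> w_ge0 w_lt2 w0_gt1.
have min2 : Num.min w 2%:R = w by apply/min_idPl; rewrite ltW.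
have min_ge0 n : 0 <= Num.min w n%:R by rewrite le_min w_ge0 ler0n.
have min1 d : 1 <= d -> d + Num.min w 1%:R < 2 -> Num.min w 1%:R = w.
  by move=> d1 h; have [//|w1] := leP w 1%:R; move: h; rewrite min_r ?(ltW w1) //; lra.
case: ab ac bc => [] [] [] //= _ _; rewrite ?addn0 ?add0n ?addn1 ?min2.
- by rewrite lerDl min_ge0.
- by rewrite lerDl min_ge0.
- by move=> /min1-> //; [rewrite lerDl min_ge0 | rewrite ltW].
- by rewrite lerDr min_ge0.
- by rewrite lerDr min_ge0.
- by move=> _ /min1->; rewrite ?lerDr ?min_ge0.
Qed.

(* If no candidate of [{a, b, c}] collected 2, then [a] and [b] together would collect
   [1 + w s0] from [s0] and at least [w s] from every other [s], hence 4. *)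
Lemma cap_sum_three_ordered (R : realType) (m : nat)
    (w : {ffun {perm 'I_m} -> R}) (a b c : 'I_m) (s0 : {perm 'I_m}) :
  (forall s, 0 <= w s) -> \sum_s w s = 3 -> 1 < w s0 ->
  (s0 a < s0 b)%N -> (s0 b < s0 c)%N ->
  exists2 x, x \in [set a; b; c] &
    2 <= \sum_s Num.min (w s) (u_in s x [set a; b; c])%:R.
Proof.
move=> w_ge0 sumw ws0 s0ab s0bc.
have ab : a != b by apply: contraTneq s0ab => ->; rewrite ltnn.
have bc : b != c by apply: contraTneq s0bc => ->; rewrite ltnn.
have ac : a != c by apply: contraTneq (ltn_trans s0ab s0bc) => ->; rewrite ltnn.
set X := [set a; b; c].
have ua s : u_in s a X = ((s a < s b) + (s a < s c))%N by exact: u_in3.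
have ub s : u_in s b X = ((s b < s a) + (s b < s c))%N.
  by rewrite /X (setUC [set a]); apply: u_in3; rewrite // eq_sym.
pose T x s : R := Num.min (w s) (u_in s x X)%:R.
have T_ge0 x s : 0 <= T x s by rewrite le_min w_ge0 ler0n.
have two x s s' : s != s' -> T x s + T x s' <= \sum_s T x s.
  move=> ss'; rewrite (bigD1 s) //= (bigD1 s') 1?eq_sym //= lerD2l lerDl.
  exact: sumr_ge0.
have one x s : T x s <= \sum_s T x s.
  by rewrite (bigD1 s) //= lerDl; exact: sumr_ge0.
have wtwo s : s != s0 -> w s + w s0 <= 3.
  move=> ss0; rewrite -sumw (bigD1 s) //= (bigD1 s0) 1?eq_sym //= lerD2l lerDl.
  exact: sumr_ge0.
have aX : a \in X by rewrite !inE eqxx.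
have bX : b \in X by rewrite !inE eqxx orbT.
have [ha|ha] := leP 2 (\sum_s T a s); first by exists a.
have [hb|hb] := leP 2 (\sum_s T b s); first by exists b.
exfalso.
have Ta0 : T a s0 = w s0.
  have := le_lt_trans (one a s0) ha; rewrite /T ua s0ab (ltn_trans s0ab s0bc).
  by rewrite addn1 /= /Num.min; case: (ltP (w s0) _) => // h1 h2; exfalso; lra.
have Tb0 : T b s0 = 1.
  rewrite /T ub s0bc [(s0 b < _)%N]ltnNge (ltnW s0ab).
  by rewrite /= /Num.min; case: ltP => //; lra.
have ws0lt : w s0 < 2 by rewrite -Ta0; exact: le_lt_trans (one a s0) ha.
have Tab s : s != s0 -> w s <= T a s + T b s.
  move=> ss0; have ws := wtwo s ss0; have w0 := w_ge0 s.
  have := le_lt_trans (two b _ _ ss0) hb; have := le_lt_trans (two a _ _ ss0) ha.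
  rewrite ![_ + T _ s0]addrC Ta0 Tb0 /T ua ub.
  have -> : (s b < s a)%N = ~~ (s a < s b)%N.
    have : s a != s b :> nat by rewrite (inj_eq val_inj) (inj_eq perm_inj).
    by case: ltngtP.
  apply: two_of_three => //; first by clear - ws ws0; lra.
    by apply/negP => /and3P[h1 h2 h3]; rewrite (ltn_trans h1 h3) in h2.
  apply/negP => /and3P[]; rewrite -!leqNgt => h1 h2 h3.
  by have := leq_ltn_trans (leq_trans h3 h1) h2; rewrite ltnn.
have : \sum_s (T a s + T b s - w s) < 1.
  by rewrite sumrB big_split /= sumw; lra.
apply/negP; rewrite -leNgt (bigD1 s0) //= Ta0 Tb0.
have : 0 <= \sum_(s | s != s0) (T a s + T b s - w s).
  by apply: sumr_ge0 => s ss0; rewrite subr_ge0 Tab.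
lra.
Qed.

(** If some weight exceeds 1, [cap_sum_three_ordered] applies once the candidates are named in the
    order of that ranking. Otherwise each ranking gives its full weight to both its first and its
    second candidate, so the three totals add up to at least 6. *)
Lemma cap_sum_three (R : realType) (m : nat)
    (w : {ffun {perm 'I_m} -> R}) (X : {set 'I_m}) :
  #|X| = 3%N -> (forall s, 0 <= w s) -> \sum_s w s = 3 ->
  exists2 x, x \in X & 2 <= \sum_s Num.min (w s) (u_in s x X)%:R.
Proof.
move=> X3 w_ge0 sumw.
have [[s0 ws0]|small] := pselect (exists s, 1 < w s).
  have /card_gt2P[a [b [c [[aX bX cX] [ab bc ca]]]]] : (2 < #|X|)%N by rewrite X3.
  have ac : a != c by rewrite eq_sym.
  have XE : X = [set a; b; c].
    apply/esym/eqP; rewrite eqEcard X3 subUset subUset !sub1set aX bX cX /=.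
    by rewrite setUC cardsU1 cards2 !inE ab (negbTE ca) eq_sym (negbTE bc).
  have E1 : [set b; a; c] = X.
    by apply/setP => z; rewrite XE !inE; case: (z == a); case: (z == b); case: (z == c).
  have E2 : [set a; c; b] = X.
    by apply/setP => z; rewrite XE !inE; case: (z == a); case: (z == b); case: (z == c).
  have E3 : [set c; a; b] = X.
    by apply/setP => z; rewrite XE !inE; case: (z == a); case: (z == b); case: (z == c).
  have E4 : [set b; c; a] = X.
    by apply/setP => z; rewrite XE !inE; case: (z == a); case: (z == b); case: (z == c).
  have E5 : [set c; b; a] = X.
    by apply/setP => z; rewrite XE !inE; case: (z == a); case: (z == b); case: (z == c).
  have nab : s0 a != s0 b :> nat by rewrite (inj_eq val_inj) (inj_eq perm_inj).
  have nac : s0 a != s0 c :> nat by rewrite (inj_eq val_inj) (inj_eq perm_inj).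
  have nbc : s0 b != s0 c :> nat by rewrite (inj_eq val_inj) (inj_eq perm_inj).
  have L x y z := @cap_sum_three_ordered R m w x y z s0 w_ge0 sumw ws0.
  have [h1|h1|h1] := ltngtP (s0 a) (s0 b); last by rewrite h1 eqxx in nab.
    have [h2|h2|h2] := ltngtP (s0 b) (s0 c); last by rewrite h2 eqxx in nbc.
      by rewrite XE; apply: L.
    have [h3|h3|h3] := ltngtP (s0 a) (s0 c); last by rewrite h3 eqxx in nac.
      by rewrite -E2; apply: L.
    by rewrite -E3; apply: L.
  have [h2|h2|h2] := ltngtP (s0 a) (s0 c); last by rewrite h2 eqxx in nac.
    by rewrite -E1; apply: L.
  have [h3|h3|h3] := ltngtP (s0 b) (s0 c); last by rewrite h3 eqxx in nbc.
    by rewrite -E4; apply: L.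
  by rewrite -E5; apply: L.
have wle s : w s <= 1 by rewrite leNgt; apply/negP => h; apply: small; exists s.
have sum6 : \sum_(x in X) \sum_s Num.min (w s) (u_in s x X)%:R >= 6 :> R.
  rewrite exchange_big /=.
  suff : \sum_s 2 * w s <= \sum_s \sum_(x in X) Num.min (w s) (u_in s x X)%:R :> R.
    by rewrite -mulr_sumr sumw; lra.
  apply: ler_sum => s _.
  apply: (@le_trans _ _ (\sum_(x in X) w s * (0 < u_in s x X)%N%:R)); last first.
    apply: ler_sum => x _; case: (u_in s x X) => [|u] /=.
      by rewrite mulr0 le_min w_ge0 lexx.
    by rewrite mulr1 le_min lexx (le_trans (wle s)) // ler1n.
  rewrite -mulr_sumr mulrC ler_wpM2l // -natr_sum ler_nat.
  have [x xX ux] : exists2 x, x \in X & u_in s x X = 2%N.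
    by have := @exists_top _ s X; rewrite X3; apply.
  (* The three utilities add up to 3 and the top one is 2, so another one is positive. *)
  have := @sum_u_in _ s X; rewrite X3 (bigD1 x) //= ux => rest.
  rewrite (bigD1 x) //= ux /= ltnS lt0n; apply: contra_eqN rest => /eqP/eqP.
  rewrite sum_nat_eq0 => /forall_inP z0.
  by rewrite big1 // => i iX; have := z0 i iX; case: (u_in s i X).
apply: contrapT => none.
have : \sum_(x in X) \sum_s Num.min (w s) (u_in s x X)%:R < \sum_(x in X) (2 : R).
  have /card_gt0P[x0 x0X] : (0 < #|X|)%N by rewrite X3.
  apply: ltr_sum => [|x xX]; last first.
    by rewrite ltNge; apply/negP => h; apply: none; exists x.
  by apply/hasP; exists x0; rewrite ?mem_index_enum.
by rewrite sumr_const X3 -mulr_natr; lra.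
Qed.

(** * Binomial coefficients *)

Lemma natr_bin2 (R : realType) (n : nat) :
  ('C(n, 2))%:R = n%:R * (n%:R - 1) / 2 :> R.
Proof.
case: n => [|n]; first by rewrite !mul0r.
have := mul_bin_diag n.+1 1; rewrite bin1 => /(congr1 (fun k => k%:R : R)).
by rewrite !natrM -natr1 /= => h; lra.
Qed.

Lemma natr_bin2S (R : realType) (n : nat) :
  ('C(n.+1, 2))%:R = ('C(n, 2))%:R + n%:R :> R.
Proof. by rewrite binS bin1 natrD. Qed.

(** At least half of the total budget survives the first [m %/ 4] rounds. At n = 3m/4, 2n(n - 1) -
    m(m - 1) = m(m - 4)/8, nonnegative for m >= 4; a larger n only helps. *)
Lemma bin2_three_quarters (m : nat) :
  (4 <= m)%N -> ('C(m, 2) <= 2 * 'C(m - m %/ 4, 2))%N.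
Proof.
move=> m4; rewrite !bin2.
suff : (m * m.-1 <= 2 * ((m - m %/ 4) * (m - m %/ 4).-1))%N.
  (* Evenness of this product makes the halving in [bin2] exact. *)
  set n := (m - m %/ 4)%N; have : odd (n * n.-1) = false.
    by case: n => //= n; rewrite oddM /=; case: odd.
  lia.
have : (4 * (m %/ 4) <= m)%N by lia.
move: (m %/ 4)%N => q; nia.
Qed.

(** * Budgets and prices along a run *)

Section Run.
Variables (R : realType) (m : nat) (P : {ffun {perm 'I_m} -> R}).
Variables (t : {perm 'I_m}) (b : nat -> {ffun {perm 'I_m} -> R}).
Variable rho : nat -> option R.
Hypothesis m_ge4 : (4 <= m)%N.
Hypothesis profileP : is_profile P.
Hypothesis b0E : forall s, b 0%N s = P s * ('C(m, 2))%:R.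
Hypothesis rounds : forall k : 'I_m, (k < m - 2)%N ->
  is_rho (b 0%N) (b k) (remaining t k) k ((t^-1)%g k) (rho k) /\
  (forall x r, x \in remaining t k ->
     is_rho (b 0%N) (b k) (remaining t k) k x r -> le_orho (rho k) r) /\
  (forall s, b k.+1 s =
     b k s - charge (b 0%N) (b k) (remaining t k) ((t^-1)%g k) (rho k) s).

Local Notation M := (('C(m, 2))%:R : R).
Local Notation X := (remaining t).
Local Notation left_over k := (('C(m - k, 2))%:R : R).
Local Notation u k s := ((u_in s ((t^-1)%g k) (X k))%:R : R).
Local Notation paid k s :=
  (charge (b 0%N) (b k) (X k) ((t^-1)%g k) (rho k) s).

Lemma P_ge0 s : 0 <= P s. Proof. by case: profileP. Qed.

Lemma M_gt0 : 0 < M.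
Proof. by rewrite ltr0n bin_gt0; lia. Qed.

Lemma b0_ge0 s : 0 <= b 0%N s.
Proof. by rewrite b0E mulr_ge0 ?P_ge0. Qed.

Lemma u_le (k : 'I_m) s : u k s <= (m - k.+1)%:R.
Proof.
have xX : (t^-1)%g k \in X k by rewrite inE permKV.
by rewrite ler_nat; have := @u_in_lt _ s _ _ xX; rewrite card_remaining; lia.
Qed.

Lemma charge_bounds (k : 'I_m) s : (k < m - 2)%N ->
  0 <= b k s <= b 0%N s -> 0 <= paid k s <= b k s.
Proof.
move=> km /andP[bk0 bkb]; have [isr _] := rounds k km.
rewrite /charge; case: (rho k) isr => [r /= [r0 _]|_].
  by rewrite !le_min !ge_min bk0 ler0n lexx !mulr_ge0 //= ?orbT // b0_ge0.
by rewrite le_min ge_min bk0 ler0n lexx.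
Qed.

(** Prices above 1 act like price 1: a charge never exceeds the current budget, itself at most
    [b 0 s], and zero utility is charged nothing. *)
Lemma charge_le_utility (k : 'I_m) s :
  0 <= b k s <= b 0%N s -> paid k s <= b 0%N s * u k s.
Proof.
move=> /andP[bk0 bkb].
have : Num.min (b k s) (u k s) <= b 0%N s * u k s.
  case: (u_in _ _ _) => [|v]; first by rewrite mulr0 ge_min lexx orbT.
  apply: (@le_trans _ _ (b k s)); first by rewrite ge_min lexx.
  by rewrite (le_trans bkb) // ler_peMr ?b0_ge0 // ler1n.
by rewrite /charge; case: (rho k) => [r|] //; apply: le_trans; rewrite ge_min lexx orbT.
Qed.

Lemma charge_le_rho (k : 'I_m) s (r a : R) :
  rho k = Some r -> r <= a -> paid k s <= a * b 0%N s * u k s.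
Proof.
move=> -> ra; rewrite /charge ge_min; apply/orP; left.
by rewrite ler_wpM2r // ler_wpM2r // b0_ge0.
Qed.

(** A candidate affordable at [a] has a least price at most [a], so the minimizing choice has a
    finite price, no larger, and collects the exact cost of the round. *)
Lemma rho_le_affordable (k : 'I_m) (x : 'I_m) (a : R) : (k < m - 2)%N ->
  (forall s, 0 <= b k s) -> x \in X k -> 0 <= a ->
  (m - k.+1)%:R <= pay (b 0%N) (b k) (X k) x a ->
  exists r, [/\ rho k = Some r, r <= a & \sum_s paid k s = (m - k.+1)%:R].
Proof.
move=> km bk0 xX a0 /(exists_is_rho _ _ _ _ _ _ _ _ b0_ge0 bk0 a0) [r isr ra].
have [isk [minr _]] := rounds k km.
have := minr _ _ xX isr; case: (rho k) isk => [r' /= [_ [payE _]] r'r|//].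
by exists r'; split => //; apply: le_trans ra.
Qed.

Definition budget_ok (k : nat) :=
  (forall s, 0 <= b k s <= b 0%N s) /\ \sum_s b k s = left_over k.

Lemma round_cost (k : 'I_m) : (k < m - 2)%N -> budget_ok k ->
  exists r, [/\ rho k = Some r, \sum_s paid k s = (m - k.+1)%:R &
    (4 <= m - k)%N -> r <= 2 / left_over k].
Proof.
move=> km [bk sumb]; have bk0 s : 0 <= b k s by case/andP: (bk s).
have cardX : #|X k| = (m - k)%N by exact: card_remaining.
have cardX1 : #|X k|.-1 = (m - k.+1)%N by rewrite cardX; lia.
have [n4|n3] := leqP 4 (m - k).
  have T_gt0 : 0 < left_over k by rewrite ltr0n bin_gt0; lia.
  have [|s|x xX] := @affordable_candidate R m (b 0%N) (b k) (b k) (X k) _ _ T_gt0 sumb bk.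
  - by rewrite cardX; lia.
  (* With n candidates left the requirement is 2(n - 1) <= C(n, 2), that is n >= 4; three candidates
     are treated separately below. *)
  - rewrite cardX1 ler_pdivrMr // -mulrA mulrCA ler_wpM2l //.
    rewrite natr_bin2 (_ : (m - k.+1)%:R = (m - k)%:R - 1); last first.
      by rewrite -(@natrB _ _ 1) -?subnDA ?addn1 //; lia.
    have : 4 <= (m - k)%:R :> R by rewrite ler_nat.
    by move: (m - k)%:R => n n4'; nra.
  - rewrite cardX1 => /(rho_le_affordable _ _ _ km bk0 xX) [|r [rE ra sumE]].
      by rewrite divr_ge0.
    by exists r.
have {}n3 : (m - k = 3)%N by lia.
have [||x xX hx] := @cap_sum_three R m (b k) (X k) _ bk0.
- by rewrite cardX.
- by rewrite sumb n3.
have : (m - k.+1)%:R <= pay (b 0%N) (b k) (X k) x 1.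
  rewrite (_ : (m - k.+1 = 2)%N); last lia.
  apply: le_trans hx _; apply: ler_sum => s _.
  (* At price 1 the term [b 0 s * u] is at least [b k s] unless the utility is 0, so only the caps
     by budget and utility matter. *)
  rewrite mul1r le_min lexx andbT.
  case: (u_in _ _ _) => [|v]; first by rewrite mulr0 ge_min lexx orbT.
  rewrite ge_min; apply/orP; left; have /andP[_ h] := bk s.
  by rewrite (le_trans h) // ler_peMr ?b0_ge0 // ler1n.
move=> /(rho_le_affordable _ _ _ km bk0 xX ler01) [r [rE _ sumE]].
by exists r; split => //; rewrite n3.
Qed.

(** A round with n unplaced candidates collects n - 1, and C(n, 2) - (n - 1) = C(n - 1, 2). *)
Lemma budget_okP (k : nat) : (k <= m - 2)%N -> budget_ok k.
Proof.
elim: k => [_|k IH km].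
  split => [s|]; first by rewrite b0_ge0 lexx.
  under eq_bigr do rewrite b0E.
  by rewrite -mulr_suml; case: profileP => _ ->; rewrite mul1r subn0.
have km' : (k < m)%N by lia.
have ok : budget_ok k by apply: IH; lia.
pose i := Ordinal km'.
have [_ [_ bS]] := rounds i km; have [bk sumb] := ok.
have [r [_ sumE _]] := round_cost i km ok.
split => [s|].
  have /andP[c0 cb] := charge_bounds i s km (bk s).
  have /andP[b0 bb] := bk s; rewrite bS /=.
  by rewrite subr_ge0 cb /= (le_trans _ bb) // lerBlDr lerDl.
under eq_bigr do rewrite bS.
rewrite sumrB sumE sumb /=.
by rewrite (_ : (m - k = (m - k.+1).+1)%N) ?natr_bin2S ?addrK //; lia.
Qed.

(* While fewer than a quarter of the positions are filled, no budget has run below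
   what the price [2 / M] asks for, so that price remains affordable. *)
Lemma early_rounds (k : nat) : (k <= m %/ 4)%N ->
  (forall s, P s * (2 * left_over k - M) <= b k s) /\
  (forall i : 'I_m, (i < k)%N -> exists2 r, rho i = Some r & r <= 2 / M).
Proof.
elim: k => [_|k IH kq].
  by split => // s; rewrite subn0 b0E ler_wpM2l ?P_ge0 //; lra.
have [low early] := IH (ltnW kq).
have km' : (k < m)%N by lia.
have km : (k < m - 2)%N by lia.
pose i := Ordinal km'.
have [bk sumb] : budget_ok k by apply: budget_okP; lia.
have bk0 s : 0 <= b k s by case/andP: (bk s).
have cardX : #|X k| = (m - k)%N by exact: card_remaining.
have cardX1 : #|X k|.-1 = (m - k.+1)%N by rewrite cardX; lia.
have TS : left_over k = left_over k.+1 + (m - k.+1)%:R.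
  by rewrite (_ : (m - k = (m - k.+1).+1)%N) ?natr_bin2S //; lia.
(* This keeps the price affordable: the demand [2 * P s * (m - k.+1)] must fit below
   [P s * (2 * left_over k - M)]. *)
have half : M <= 2 * left_over k.+1.
  rewrite -natrM ler_nat (leq_trans (bin2_three_quarters _ m_ge4)) // leq_mul2l /=.
  by apply: leq_bin2l; lia.
have [r rE ra] : exists2 r, rho i = Some r & r <= 2 / M.
  have [||s|s|x xX] := @affordable_candidate R m (b 0%N) (b k) (b 0%N) (X k) M _ M_gt0.
  - by rewrite cardX; lia.
  - under eq_bigr do rewrite b0E.
    by rewrite -mulr_suml; case: profileP => _ ->; rewrite mul1r.
  - by rewrite b0_ge0 lexx.
  - rewrite cardX1; apply: le_trans (low s).
    rewrite b0E (_ : _ / M = P s * (2 * (m - k.+1)%:R)); last first.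
      by field; rewrite gt_eqF ?M_gt0.
    by rewrite ler_wpM2l ?P_ge0 //; lra.
  - rewrite cardX1 => /(rho_le_affordable i _ _ km bk0 xX) [|r [rE ra _]].
      by rewrite divr_ge0.
    by exists r.
split => [s|j]; last first.
  rewrite ltnS leq_eqVlt => /orP[/eqP jk|]; last exact: early.
  by rewrite (_ : j = i) ?rE; [exists r | exact: val_inj].
(* The charge is at most [2 * P s * (m - k.+1)], which is exactly how much the lower bound drops
   from [k] to [k.+1]. *)
have [_ [_ bS]] := rounds i km; rewrite bS /=.
have := charge_le_rho i s _ _ rE ra; have := low s; rewrite TS /= b0E.
have ui := u_le i s; rewrite /= in ui.
rewrite (_ : 2 / M * (P s * M) = 2 * P s); last by field; rewrite gt_eqF ?M_gt0.
have : P s * u i s <= P s * (m - k.+1)%:R by rewrite ler_wpM2l ?P_ge0.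
rewrite /=; move: (charge _ _ _ _ _ _) => z; nra.
Qed.

(** * Budget and utility of a group *)

Variable S : {ffun {perm 'I_m} -> R}.
Hypothesis subS : is_subprofile P S.

(* [0] when [P s = 0], in which case [S s = 0] too. *)
Definition share s : R := S s / P s.
Definition group_budget (k : nat) : R := \sum_s share s * b k s.
(** The weight [share s * b 0 s] is [S s * M]: utilities carry a factor [M] so that a price compares
    them directly with charges. *)
Definition group_utility (k : 'I_m) : R := \sum_s share s * (b 0%N s * u k s).
Definition utility_from (k : nat) : R := \sum_(i < m | (k <= i)%N) group_utility i.

Lemma share_bounds s : 0 <= share s <= 1.
Proof.
have /andP[S0 SP] := subS s; rewrite /share.
have [->|P0] := eqVneq (P s) 0; first by rewrite invr0 mulr0 lexx ler01.
have {}P0 : 0 < P s by rewrite lt_neqAle eq_sym P0 P_ge0.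
by rewrite divr_ge0 ?(ltW P0) //= ler_pdivrMr // mul1r.
Qed.

Lemma share_b0 s : share s * b 0%N s = S s * M.
Proof.
rewrite b0E mulrA /share; have /andP[S0 SP] := subS s.
have [P0|P0] := eqVneq (P s) 0; last by rewrite divfK.
have -> : S s = 0 by apply/eqP; rewrite eq_le S0 -P0 SP.
by rewrite !mul0r.
Qed.

Lemma group_utility_ge0 k : 0 <= group_utility k.
Proof.
apply: sumr_ge0 => s _; have /andP[? _] := share_bounds s.
by rewrite mulr_ge0 // mulr_ge0 // b0_ge0.
Qed.

Lemma utility_from_ge0 k : 0 <= utility_from k.
Proof. by apply: sumr_ge0 => i _; exact: group_utility_ge0. Qed.

Lemma utility_from_step (k : 'I_m) :
  utility_from k = group_utility k + utility_from k.+1.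
Proof.
rewrite /utility_from (bigD1 k) //=; congr (_ + _); apply: eq_bigl => i.
by rewrite -(inj_eq val_inj) /=; lia.
Qed.

Lemma utility_from0 : utility_from 0 = M * \sum_s S s * (u_pair s t)%:R.
Proof.
rewrite /utility_from /group_utility exchange_big /= mulr_sumr.
apply: eq_bigr => s _; rewrite u_pairE natr_sum !mulr_sumr.
by apply: eq_bigr => i _; rewrite mulrA share_b0; ring.
Qed.

Lemma group_budget0 : group_budget 0 = M * mass S.
Proof.
by rewrite /group_budget mulr_sumr; apply: eq_bigr => s _; rewrite share_b0 mulrC.
Qed.

Lemma group_budget_le k : (k <= m - 2)%N -> group_budget k <= left_over k.
Proof.
move=> /budget_okP[bk <-]; apply: ler_sum => s _.
have /andP[b0 _] := bk s; have /andP[_ f1] := share_bounds s.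
by rewrite ler_piMl.
Qed.

Lemma group_budget_ge0 k : (k <= m - 2)%N -> 0 <= group_budget k.
Proof.
move=> /budget_okP[bk _]; apply: sumr_ge0 => s _.
have /andP[b0 _] := bk s; have /andP[f0 _] := share_bounds s.
by rewrite mulr_ge0.
Qed.

(** Here [a] bounds from below the weighted utility bought per unit paid. The bound holds for each
    ranking, so it survives weighting by [share]. *)
Lemma group_gain (k : 'I_m) (a : R) : (k < m - 2)%N ->
  (forall s, a * paid k s <= b 0%N s * u k s) ->
  group_budget k.+1 <= group_budget k /\
  a * (group_budget k - group_budget k.+1) <= group_utility k.
Proof.
move=> km rate; have [_ [_ bS]] := rounds k km.
have [bk _] := budget_okP k (ltnW km).
have diff : group_budget k - group_budget k.+1 = \sum_s share s * paid k s.
  by rewrite -sumrB; apply: eq_bigr => s _; rewrite bS; ring.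
split.
  rewrite -subr_ge0 diff; apply: sumr_ge0 => s _.
  have /andP[f0 _] := share_bounds s.
  by have /andP[c0 _] := charge_bounds k s km (bk s); rewrite mulr_ge0.
rewrite diff mulr_sumr; apply: ler_sum => s _; have /andP[f0 _] := share_bounds s.
by rewrite mulrCA ler_wpM2l.
Qed.

Lemma group_gain_rho (k : 'I_m) (W r : R) : (k < m - 2)%N -> 0 < W ->
  rho k = Some r -> r <= 2 / W ->
  group_budget k.+1 <= group_budget k /\
  W / 2 * (group_budget k - group_budget k.+1) <= group_utility k.
Proof.
move=> km W0 rE rW; apply: group_gain => // s.
have /(ler_wpM2l (divr_ge0 (ltW W0) (ler0n R 2))) := charge_le_rho k s _ _ rE rW.
move/le_trans; apply; rewrite [leLHS](_ : _ = b 0%N s * u k s) //.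
by field; rewrite gt_eqF.
Qed.

(** * Lower bounds on the utility of a group *)

Hypothesis last_pair : forall (k1 k2 : 'I_m),
  val k1 = (m - 2)%N -> val k2 = (m - 1)%N ->
  \sum_(s | above s ((t^-1)%g k2) ((t^-1)%g k1)) b (m - 2)%N s <=
  \sum_(s | above s ((t^-1)%g k1) ((t^-1)%g k2)) b (m - 2)%N s.

(** One unit of budget is left in total, and the majority rule leaves at most half of it with the
    rankings that disagree with the outcome. The rest of the group's budget sits on rankings of
    utility 1, weighted by [b 0 s], which is at least the remaining budget. *)
Lemma utility_from_last : group_budget (m - 2) - 2^-1 <= utility_from (m - 2).
Proof.
have [bk sumb] := budget_okP _ (leqnn (m - 2)).
have k1m : (m - 2 < m)%N by lia.
have k2m : (m - 1 < m)%N by lia.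
pose k1 := Ordinal k1m; pose k2 := Ordinal k2m.
have := last_pair k1 k2 erefl erefl.
set x := (t^-1)%g k1; set y := (t^-1)%g k2 => maj.
have xy : x != y.
  by rewrite (inj_eq perm_inj) -(inj_eq val_inj) /=; lia.
have ux s : u_in s x (X (m - 2)) = above s x y.
  rewrite (_ : X (m - 2) = [set x; y]); last first.
    apply/setP => z; have zE k : (z == (t^-1)%g k) = (t z == k :> nat).
      by rewrite -(inj_eq (@perm_inj _ t)) permKV -(inj_eq val_inj).
    by rewrite !inE !zE /=; have := ltn_ord (t z); lia.
  by rewrite u_inE big_setU1 ?inE //= big_set1 ltnn.
have aboveN s : above s y x = ~~ above s x y.
  have : s x != s y :> nat by rewrite (inj_eq val_inj) (inj_eq perm_inj).
  by rewrite /above; case: ltngtP.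
have sum1 : \sum_(s | above s x y) b (m - 2)%N s +
            \sum_(s | ~~ above s x y) b (m - 2)%N s = 1.
  have := sumb; rewrite (bigID (fun s => above s x y)) /= => ->.
  by rewrite subKn //; lia.
have disagree : \sum_(s | ~~ above s x y) b (m - 2)%N s <= 2^-1.
  by move: maj; under eq_bigl do rewrite aboveN; lra.
have agree : group_budget (m - 2) <=
    group_utility k1 + \sum_(s | ~~ above s x y) b (m - 2)%N s.
  rewrite /group_budget (bigID (fun s => above s x y)) /=; apply: lerD.
    rewrite /group_utility [leRHS](bigID (fun s => above s x y)) /=.
    rewrite [X in _ <= _ + X]big1 ?addr0 => [|s /negbTE sN]; last first.
      by rewrite ux sN !mulr0.
    apply: ler_sum => s sxy; rewrite ux sxy mulr1.
    have /andP[f0 _] := share_bounds s; have /andP[_ bb] := bk s.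
    by rewrite ler_wpM2l.
  apply: ler_sum => s _; have /andP[_ f1] := share_bounds s.
  by have /andP[b0 _] := bk s; rewrite ler_piMl.
have := utility_from_step k1; have := utility_from_ge0 k1.+1; rewrite /=; lra.
Qed.

(* The derivative c / 2 of the potential stays below the rate T / 2 for n >= 4; at n = 3
   the rate is only 1 and c - 1 / 2 >= c^2 / 4 - 1 / 16 on [1 / 2, 3] takes over. *)
Lemma utility_from_quadratic (k : nat) : (k <= m - 3)%N ->
  group_budget k ^+ 2 / 4 - 16^-1 <= utility_from k.
Proof.
move=> km3; have [j ->] : exists j, k = (m - 3 - j)%N by exists (m - 3 - k)%N; lia.
elim: j {k km3} => [|j IH].
  rewrite subn0; have k1m : (m - 3 < m)%N by lia.
  pose k := Ordinal k1m; have km : (k < m - 2)%N by rewrite /=; lia.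
  have [bk _] := budget_okP (m - 3) ltac:(lia).
  have [|mono gain] := group_gain k 1 km.
    by move=> s; rewrite mul1r charge_le_utility.
  have := group_budget_le (m - 3) ltac:(lia); rewrite subKn; last lia.
  rewrite (_ : 'C(3, 2) = 3%N) // => c3.
  have c0 := group_budget_ge0 (m - 3) ltac:(lia).
  have step := utility_from_step k.
  have lst := utility_from_last; have nonneg := utility_from_ge0 (m - 3).
  have nonneg' := utility_from_ge0 (m - 2).
  have kS : k.+1 = (m - 2)%N by rewrite /=; lia.
  rewrite kS /= in mono gain step.
  (* Below 1/2 the potential is nonpositive, so nonnegativity of the utility suffices. *)
  have [h|h] := leP (group_budget (m - 3)) 2^-1.
    by apply: le_trans nonneg; nra.
  apply: (@le_trans _ _ (group_budget (m - 3) - 2^-1)); last lra.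
  nra.
(* Truncated subtraction keeps the index at 0 from here on, and the induction hypothesis is already
   the claim. *)
have [jm|jm] := leqP (m - 3) j.
  by rewrite (_ : (m - 3 - j.+1 = m - 3 - j)%N) //; lia.
have k1m : (m - 3 - j.+1 < m)%N by lia.
pose k := Ordinal k1m; have km : (k < m - 2)%N by rewrite /=; lia.
have [r [rE _ /(_ ltac:(rewrite /=; lia)) rT]] := round_cost k km (budget_okP k (ltnW km)).
have T0 : 0 < left_over k by rewrite ltr0n bin_gt0 /=; lia.
have [mono gain] := group_gain_rho k _ _ km T0 rE rT.
have := group_budget_le k (ltnW km); have := utility_from_step k.
have kS : k.+1 = (m - 3 - j)%N by rewrite /=; lia.
rewrite kS in mono gain *; rewrite -[(m - 3 - j.+1)%N]/(val k).
have c0 := group_budget_ge0 (m - 3 - j) ltac:(lia).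
move: IH mono gain c0 T0.
move: (group_budget _) (group_budget k) (left_over k) => c' c T.
move: (utility_from _) (utility_from k) (group_utility k) => V' V v.
(* The potential drops by (c - c')(c + c')/4, at most (c - c')T/2 because c' <= c <= T. *)
nra.
Qed.

Lemma utility_early (k : nat) : (k <= m %/ 4)%N ->
  M / 2 * (group_budget 0 - group_budget k) + utility_from k <= utility_from 0.
Proof.
elim: k => [_|k IH kq]; first by rewrite subrr mulr0 add0r.
have {}IH := IH (ltnW kq); have km : (k < m)%N by lia.
pose i := Ordinal km.
have [r rE rM] := (early_rounds _ kq).2 i (ltnSn k).
have [|_ gain] := group_gain_rho i _ _ _ M_gt0 rE rM; first by rewrite /=; lia.
have := utility_from_step i; rewrite /= in gain *; nra.
Qed.

End Run.

Theorem mainTheorem8 (R : realType) (m : nat) (P : {ffun {perm 'I_m} -> R})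
    (t : {perm 'I_m}) :
  (4 <= m)%N ->
  is_profile P ->
  rmes_outcome P t ->
  forall S : {ffun {perm 'I_m} -> R},
    is_subprofile P S -> 0 < mass S ->
    let M : R := ('C(m, 2))%:R in
    let xi : R := ('C(m - m %/ 4, 2))%:R in
    let avg : R := (\sum_s S s * (u_pair s t)%:R) / mass S in
    (M * mass S - 2^-1 <= xi ->
       avg >= M * mass S / 4%:R - 8%:R^-1) /\
    (M * mass S - 2^-1 > xi ->
       avg >= 2^-1 * M * (1 - xi / (M * mass S))
              + (xi + 1) / 4%:R * (xi / (M * mass S))
              - (4%:R * mass S)^-1).
Proof.
move=> m4 profP [b [rho [b0E [rounds lastp]]]] S subS mass0 M xi avg.
have M0 : 0 < M by apply: M_gt0.
pose B := M * mass S; have B0 : 0 < B by rewrite mulr_gt0.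
pose V : R := utility_from R m P t b S 0.
have avgE : avg = V / B.
  rewrite /V (utility_from0 R m P t b b0E S subS) /avg /B /M.
  by field; rewrite !gt_eqF //=.
have c0E : group_budget R m P b S 0 = B by exact: group_budget0.
rewrite avgE !ler_pdivlMr //; split => [_|big].
  have V0 : 0 <= V by apply: utility_from_ge0.
  have := @utility_from_quadratic R m P t b rho m4 profP b0E rounds S subS lastp 0%N isT.
  rewrite c0E -/V => quad; rewrite -/B.
  (* Multiplied by [B], the claim is V >= B^2/4 - B/8. The right side is at most 0 for B <= 1/2 and
     at most B^2/4 - 1/16 otherwise. *)
  have [h|h] := leP B 2^-1; nra.
pose q := (m %/ 4)%N.
have qm : (q <= m - 3)%N by rewrite /q; lia.
have := @utility_from_quadratic R m P t b rho m4 profP b0E rounds S subS lastp q qm.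
have := @utility_early R m P t b rho m4 profP b0E rounds S subS q (leqnn _).
have := @group_budget_le R m P t b rho m4 profP b0E rounds S subS q ltac:(lia).
rewrite c0E -/V -/xi -/M.
move: (utility_from _ _ _ _ _ _ q) (group_budget _ _ _ _ _ q) => W c cxi early quad.
have xiM : xi + 1 <= M.
  rewrite /xi /M natr1 ler_nat.
  apply: (@leq_trans 'C(m.-1, 2).+1); first by rewrite ltnS leq_bin2l //; lia.
  by rewrite -[in leqRHS](@prednK m) ?binS ?bin1; lia.
(* Since B = M |S|, the term 1/(4|S|) becomes M/4, which is the 1/2 inside the first factor. *)
rewrite [leLHS](_ : _ = M / 2 * (B - 2^-1 - xi) + (xi + 1) * xi / 4); last first.
  by rewrite /B; field; rewrite !gt_eqF.
(* With d = xi - c, the claim reduces to (M - xi)d/2 + d^2/4 + (M - xi)/4 - 1/16 >= 0, where d >= 0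
   and M - xi >= 1. *)
have : 0 <= (M - xi - 1) * (xi - c) by rewrite mulr_ge0 //; lra.
have : 0 <= (xi - c) ^+ 2 by rewrite sqr_ge0.
nra.
Qed.
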